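(* Let each $f_i:\mathbb{R}\to\mathbb{R}$, $i\in[N]$, be convex and differentiable with $|f_i'(s)-f_i'(t)|\le L_i|s-t|$ for all $s,t\in\mathbb{R}$, where $L_i>0$. Assume in addition that $f(x)=\sum_{i=1}^N f_i(x_i)$ is strongly convex on $S$ with respect to $\|\cdot\|^*_{G_\tau}$ with parameter $\sigma_{G_\tau}>0$, i.e. $$f(x)\ge f(y)+\langle\nabla f(y),x-y\rangle+\frac{\sigma_{G_\tau}}{2}\left(\|x-y\|^*_{G_\tau}\right)^2\qquad\forall x,y\in S.$$ Let $x^0\in S$, let $(x^k)_{k\ge0}$ be the random sequence generated from $x^0$ by algorithm $RCD_\tau$ with probability distribution $(p_{\mathcal N})_{\mathcal N\in\mathcal P_\tau}$, and put $\phi_k=E[f(x^k)]$. Then for all $k\ge0$ $$\phi_k-f^*\le(1-\sigma_{G_\tau})^k\left(f(x^0)-f^*\right).$$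
   Context: Problem: $f^*=\min\{f(x): x\in S\}$, where $f(x)=\sum_{i=1}^N f_i(x_i)$ for $x\in\mathbb{R}^N$ and $S=\{x\in\mathbb{R}^N:\sum_{i=1}^N x_i=0\}$. $[N]=\{1,\dots,N\}$. Graph: $\mathcal G=([N],E)$ is a connected undirected graph, $2\le\tau\le N$ is an integer, and $\mathcal P_\tau$ is the set of paths of $\tau$ (distinct) vertices in $\mathcal G$; each path $\mathcal N$ is used only through its set of $\tau$ vertices. $(p_{\mathcal N})_{\mathcal N\in\mathcal P_\tau}$ is a given probability distribution on $\mathcal P_\tau$. Algorithm $RCD_\tau$: start from $x^0\in S$. At iteration $k\ge0$, draw $\mathcal N_k\in\mathcal P_\tau$ (independently of the past) with $\Pr(\mathcal N_k=\mathcal N)=p_{\mathcal N}$; set $x_i^{k+1}=x_i^k$ for $i\notin\mathcal N_k$ and $x_i^{k+1}=x_i^k+d_i^k$ for $i\in\mathcal N_k$, where $$d_i^k=\frac1{L_i}\,\frac{\sum_{j\in\mathcal N_k}\frac1{L_j}\left(f_j'(x_j^k)-f_i'(x_i^k)\right)}{\sum_{j\in\mathcal N_k}\frac1{L_j}}.$$ Matrix $G_\tau$: for $\mathcal N\in\mathcal P_\tau$ let $\ell_{\mathcal N}\in\mathbb{R}^N$ have entries $1/L_i$ for $i\in\mathcal N$ and $0$ otherwise, and let $G_{\mathcal N}=\mathrm{diag}(\ell_{\mathcal N})-\frac{1}{\sum_{i\in\mathcal N}1/L_i}\,\ell_{\mathcal N}\ell_{\mathcal N}^T$. Put $G_\tau=\sum_{\mathcal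 N\in\mathcal P_\tau}p_{\mathcal N}G_{\mathcal N}$. This matrix is positive semidefinite with $G_\tau e=0$, where $e$ is the all-ones vector. Standing assumption: the eigenvalue $0$ of $G_\tau$ is simple, i.e. its second smallest eigenvalue is positive. Norms: $\|u\|_{G_\tau}=\sqrt{u^TG_\tau u}$ for $u\in\mathbb{R}^N$, and $\|x\|^*_{G_\tau}=\max\{\langle x,u\rangle: u\in\mathbb{R}^N,\ \|u\|_{G_\tau}\le1\}$ for $x\in S$. *)

(* Defs.v *)
From HB Require Import structures.
From mathcomp Require Import all_boot all_order all_algebra.
From mathcomp Require Import all_classical all_reals all_analysis.
Set Implicit Arguments.
Unset Strict Implicit.
Unset Printing Implicit Defensive.
Import Order.TTheory GRing.Theory Num.Theory.
Import numFieldNormedType.Exports.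
Local Open Scope classical_set_scope.
Local Open Scope ring_scope.

(* Paths are traversed vertex sequences, so a path and its reversal are two
   elements of this type.  They have the same vertex set, and the distribution
   on paths is arbitrary, so a distribution on unoriented paths is the special
   case that charges one chosen orientation of each path. *)
Definition gpath (n : nat) (e : rel 'I_n) (tau : nat) :=
  {s : tau.-tuple 'I_n | uniq s && sorted e s}.

Definition vertices (n : nat) (e : rel 'I_n) (tau : nat) (N : gpath e tau) :
  {set 'I_n} := [set i in val N].

Definition is_distribution (R : realType) (I : finType) (p : I -> R) :=
  (forall i, 0 <= p i) /\ \sum_i p i = 1.

Section Vectors.
Context {R : realType} {n : nat}.
Implicit Types (x y u : 'cV[R]_n) (G : 'M[R]_n) (F : 'cV[R]_n -> R).

Definition dotv x y : R := \sum_i x i 0 * y i 0.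

Definition zero_sum : set 'cV[R]_n := [set x | \sum_i x i 0 = 0].

Definition grad F x : 'cV[R]_n := \col_i 'D_(delta_mx i 0) F x.

Definition mxnorm G u : R := Num.sqrt ((u^T *m G *m u) 0 0).

(* The supremum is only meaningful (and is then a maximum) at those x where the
   set is bounded above; [sup] is 0 on unbounded sets. *)
Definition dual_mxnorm G x : R := sup [set dotv x u | u in [set u | mxnorm G u <= 1]].

Definition strongly_convex_on (S : set 'cV[R]_n) (nrm : 'cV[R]_n -> R)
    F (sigma : R) :=
  forall x y, S x -> S y ->
    F x >= F y + dotv (grad F y) (x - y) + sigma / 2 * nrm (x - y) ^+ 2.

Definition simple_eigenvalue G (a : R) := mup a (char_poly G) = 1%N.

End Vectors.

Definition sepfun (R : realType) (n : nat) (f : 'I_n -> R -> R) (x : 'cV[R]_n) : R :=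
  \sum_i f i (x i 0).

Section RCD.
Context {R : realType} {n : nat} (e : rel 'I_n) (tau : nat).
Variables (f : 'I_n -> R -> R) (L : 'I_n -> R).
Implicit Types (N : gpath e tau) (x : 'cV[R]_n).

Definition rcd_dir N x (i : 'I_n) : R :=
  (L i)^-1 *
  ((\sum_(j in vertices N) (L j)^-1 * (derive1 (f j) (x j 0) - derive1 (f i) (x i 0))) /
   (\sum_(j in vertices N) (L j)^-1)).

Definition rcd_step N x : 'cV[R]_n :=
  \col_i (if i \in vertices N then x i 0 + rcd_dir N x i else x i 0).

Fixpoint rcd (x0 : 'cV[R]_n) (draws : nat -> gpath e tau) (k : nat) : 'cV[R]_n :=
  if k is k'.+1 then rcd_step (draws k') (rcd x0 draws k') else x0.

Definition ell N : 'cV[R]_n := \col_i (if i \in vertices N then (L i)^-1 else 0).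

Definition Gpath N : 'M[R]_n :=
  diag_mx (ell N)^T -
  (\sum_(i in vertices N) (L i)^-1)^-1 *: (ell N *m (ell N)^T).

Definition Gtau (p : gpath e tau -> R) : 'M[R]_n := \sum_N p N *: Gpath N.

End RCD.

(* [draws k] has law [p] and is independent of [draws 0], ..., [draws (k - 1)].
   As [I] is finite, it is enough to factorize over the values of the past. *)
Definition independent_draws (R : realType) (d : measure_display)
    (T : measurableType d) (P : probability T R) (I : finType) (p : I -> R)
    (draws : nat -> T -> I) :=
  [/\ forall k a, measurable (draws k @^-1` [set a]),
      forall k a, P (draws k @^-1` [set a]) = (p a)%:E
    & forall k (past : nat -> I) a,
        let H := [set w | forall j, (j < k)%N -> draws j w = past j] in
        P (H `&` draws k @^-1` [set a]) = (P H * P (draws k @^-1` [set a]))%E].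

(* Main.v *)
(* By the descent lemma in each coordinate, a step along the path N decreases f
   by at least half of g^T G_N g, where g is the gradient; averaging over N gives
   half of g^T G_tau g.  Strong convexity at a minimizer and Young's inequality
   for the pairing of the G_tau-seminorm with its dual bound sigma (f x - fstar)
   by the same quantity, so f - fstar contracts by 1 - sigma in conditional
   expectation.  Simplicity of the eigenvalue 0 is what makes the dual norm
   finite on zero-sum vectors, by identifying them with the range of G_tau. *)
Require Import Defs.
From HB Require Import structures.
From mathcomp Require Import all_boot all_order all_algebra.
From mathcomp Require Import all_classical all_reals all_analysis.
From mathcomp Require Import ring lra.
Set Implicit Arguments.
Unset Strict Implicit.
Unset Printing Implicit Defensive.
Import Order.TTheory GRing.Theory Num.Theory.
Import numFieldNormedType.Exports.
Local Open Scope classical_set_scope.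
Local Open Scope ring_scope.

(** * Rank of a matrix and multiplicity of the eigenvalue 0 *)

(** Factoring A as C * [pid_mx r] * Q with C and Q invertible gives X - A = C * (X C^-1 Q^-1 -
    [pid_mx r]) * Q. Every row of the middle matrix from index r on is a multiple of X, so n - r
    factors X come out of the determinant. *)
Lemma corank_dvd_char_poly (F : fieldType) n (A : 'M[F]_n) :
  'X ^+ (n - \rank A) %| char_poly A.
Proof.
set C := col_ebase A; set Q := row_ebase A; set r := \rank A.
have C_unit : C \in unitmx by exact: col_ebase_unit.
have Q_unit : Q \in unitmx by exact: row_ebase_unit.
pose pM := map_mx (@polyC F).
pose B : 'M[{poly F}]_n := \matrix_(i, j)
  (if (i < r)%N then (invmx C *m invmx Q) i j *: 'X - (pid_mx r : 'M[F]_n) i j *: 1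
   else ((invmx C *m invmx Q) i j)%:P).
pose D : 'rV[{poly F}]_n := \row_i (if (i < r)%N then 1 else 'X).
have defA : char_poly_mx A = pM _ _ C *m (diag_mx D *m B) *m pM _ _ Q.
  have -> : diag_mx D *m B =
      'X *: pM _ _ (invmx C *m invmx Q) - pM _ _ (pid_mx r : 'M[F]_n).
    apply/matrixP => i j; rewrite mul_diag_mx !mxE.
    case: ltnP => [_|rj]; rewrite ?mul1r; first by rewrite alg_polyC -mul_polyC mulrC.
    by rewrite andbF subr0.
  rewrite mulmxBr mulmxBl -!map_mxM mulmx_ebase -scalemxAr -scalemxAl -!map_mxM.
  rewrite mulmxA mulmxV// mul1mx mulVmx// /char_poly_mx /pM map_mx1.
  by rewrite scalemx1.
rewrite /char_poly defA !det_mulmx det_diag.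
have -> : \prod_i D 0 i = 'X ^+ (n - r).
  under eq_bigr do rewrite mxE.
  rewrite (bigID (fun i : 'I_n => (i < r)%N)) /= big1 => [|i ->//].
  rewrite mul1r; under eq_bigr => i /negbTE -> do [].
  rewrite big_const iter_mulr_1; congr (_ ^+ _).
  have /(congr1 (fun k => k - r)%N) := cardC [pred i : 'I_n | (i < r)%N].
  rewrite card_ord => <-.
  suff -> : #|[pred i : 'I_n | (i < r)%N]| = r by rewrite addKn.
  have rn : (r <= n)%N by exact: rank_leq_row.
  rewrite -sum1_card (eq_bigl (fun i : 'I_n => (i < r)%N))//.
  rewrite -(big_ord_widen n (fun=> 1%N) rn).
  by rewrite sum1_card card_ord.
by rewrite dvdp_mulr// dvdp_mull// dvdp_mulr.
Qed.

Lemma simple_eigenvalue0_rank (R : realType) n (A : 'M[R]_n) :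
  simple_eigenvalue A 0 -> (n.-1 <= \rank A)%N.
Proof.
rewrite /simple_eigenvalue => A1.
have : (n - \rank A <= 1)%N.
  rewrite -A1 mup_geq ?monic_neq0 ?char_poly_monic// subr0.
  exact: corank_dvd_char_poly.
by rewrite leq_subLR addn1; case: n A {A1}.
Qed.

(* A symmetric matrix of corank one maps onto the orthogonal complement of its
   kernel, here spanned by the all-ones vector. *)
Lemma zero_sum_image (R : realType) n (A : 'M[R]_n) (v : 'cV[R]_n) :
  A^T = A -> A *m const_mx 1 = 0 :> 'cV_n -> simple_eigenvalue A 0 ->
  zero_sum v -> exists w, v = A *m w.
Proof.
case: n A v => [|n] A v symA Ae simpleA v0.
  by exists 0; apply/colP => -[].
pose e : 'cV[R]_n.+1 := const_mx 1.
have rank_e : \rank e = 1%N.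
  apply/eqP; rewrite eqn_leq rank_leq_col lt0n mxrank_eq0.
  by apply/eqP => /colP/(_ 0)/eqP; rewrite !mxE oner_eq0.
have A_ker : (A <= kermx e)%MS by rewrite sub_kermx Ae.
(* The inclusion [A_ker] is an equality by dimension: [kermx e] has corank one, and simplicity
   bounds the corank of A by one. *)
have ker_A : (kermx e <= A)%MS.
  rewrite -(geq_leqif (mxrank_leqif_sup A_ker)) mxrank_ker rank_e subn1.
  exact: simple_eigenvalue0_rank.
have /submxP[w vw] : (v^T <= A)%MS.
  apply: submx_trans ker_A; rewrite sub_kermx; apply/eqP/matrixP => i j.
  rewrite !mxE -[RHS]v0; apply: eq_bigr => k _.
  by rewrite !mxE mulr1 ord1.
by exists w^T; rewrite -[v]trmxK vw trmx_mul symA.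
Qed.

(** * Calculus of the separable objective *)

(** Subtracting from g its quadratic model at t leaves h, up to the constant g t. By the Lipschitz
    bound h' is nonnegative left of t and nonpositive right of t, so the mean value theorem on
    either side shows that h is largest at t. *)
Lemma descent_lemma (R : realType) (g : R -> R) (l : R) :
  (forall t, derivable g t 1) ->
  (forall s t, `|derive1 g s - derive1 g t| <= l * `|s - t|) ->
  forall t u, g (t + u) <= g t + derive1 g t * u + l / 2 * u ^+ 2.
Proof.
move=> dg lip t u.
pose h (s : R) : R := g s - derive1 g t * (s - t) - l / 2 * (s - t) ^+ 2.
pose dh (s : R) : R := derive1 g s - derive1 g t - l * (s - t).
have is_h (s : R) : is_derive s (1 : R) h (dh s).
  have gs : is_derive s (1 : R) g (derive1 g s) by rewrite derive1E; apply/derivableP.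
  apply: is_derive_eq.
  by rewrite /dh /GRing.scale /=; field.
have cont_h (a b : R) : {within `[a, b], continuous h}.
  apply: derivable_within_continuous => x _.
  by have [] := is_h x.
suff : h (t + u) <= h t.
  by rewrite /h subrr mulr0 expr0n mulr0 !subr0 (_ : t + u - t = u); [lra|ring].
case: (ltgtP u 0) => [u0|u0|->]; last by rewrite addr0.
- have tu : t + u < t by lra.
  have [c] := MVT tu (fun x _ => is_h x) (cont_h _ _).
  rewrite in_itv /= => /andP[_ ct] htu.
  have := ler_norm (derive1 g t - derive1 g c); have := lip t c.
  have -> : `|t - c| = t - c by rewrite gtr0_norm//; lra.
  move=> lip1 lip2; have dh0 : 0 <= dh c by rewrite /dh; lra.
  have : 0 <= dh c * (t - (t + u)) by rewrite mulr_ge0//; lra.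
  lra.
- have tu : t < t + u by lra.
  have [c] := MVT tu (fun x _ => is_h x) (cont_h _ _).
  rewrite in_itv /= => /andP[tc _] htu.
  have := ler_norm (derive1 g c - derive1 g t); have := lip c t.
  have -> : `|c - t| = c - t by rewrite gtr0_norm//; lra.
  move=> lip1 lip2; have dh0 : dh c <= 0 by rewrite /dh; lra.
  have : dh c * (t + u - t) <= 0 by rewrite mulr_le0_ge0//; lra.
  lra.
Qed.

Lemma grad_sepfun (R : realType) n (f : 'I_n -> R -> R) (x : 'cV[R]_n) i :
  grad (sepfun f) x i 0 = derive1 (f i) (x i 0).
Proof.
rewrite mxE derive1E /derive.
(* The difference quotients already agree before the limit, since all coordinates other than i
   cancel. *)
suff -> : (fun h : R =>
      h^-1 *: ((sepfun f \o shift x) (h *: delta_mx i 0) - sepfun f x)) =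
    (fun h : R => h^-1 *: ((f i \o shift (x i 0)) (h *: 1) - f i (x i 0))) by [].
apply/funext => h; congr (_ *: _).
rewrite /sepfun /= -sumrB (bigD1 i)//= big1 ?addr0 => [|j ji].
  by rewrite !mxE !eqxx mulr1 /GRing.scale/= mulr1.
by rewrite !mxE (negbTE ji) mulr0 add0r subrr.
Qed.

(** * Expectation of a function of a finite-valued variable *)

Lemma expectation_comp_fin (R : realType) d (T : measurableType d)
    (P : probability T R) (J : finType) (Z : T -> J) (Phi : J -> R) :
  (forall j, measurable (Z @^-1` [set j])) ->
  ('E_P[Phi \o Z] = (\sum_j Phi j * fine (P (Z @^-1` [set j])))%R%:E)%E.
Proof.
move=> mZ; rewrite unlock.
have -> : (fun w => ((Phi \o Z) w)%:E) = (fun w =>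
    \sum_j (Phi j)%:E * (\1_(Z @^-1` [set j]) w)%:E)%E.
  apply/funext => w /=; rewrite (bigD1 (Z w))//= big1 ?adde0 => [|j ji].
    by rewrite indicE mem_set//= mule1.
  by rewrite indicE memNset ?mule0//= => /esym/eqP; rewrite (negbTE ji).
have int1 j : P.-integrable [set: T] (fun w => (\1_(Z @^-1` [set j]) w)%:E).
  exact: integrable_indic.
rewrite integral_sum// => [|j]; last exact: integrableZl.
rewrite -sumEFin; apply: eq_bigr => j _.
rewrite integralZl// integral_indic// setIT EFinM fineK//.
exact: fin_num_measure.
Qed.

(** * Bilinear forms and weighted means *)

Definition bilin {R : realType} {n} (A : 'M[R]_n) (u w : 'cV[R]_n) : R :=
  (u^T *m A *m w) 0 0.

Definition weighted_mean {R : realFieldType} {I : finType} (A : {set I})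
    (a u : I -> R) : R :=
  (\sum_(i in A) a i)^-1 * \sum_(i in A) a i * u i.

Section WeightedMean.
Context {R : realFieldType} {I : finType}.
Variables (A : {set I}) (a : I -> R).
Hypothesis a_gt0 : forall i, 0 < a i.

(* If [A] is empty, both sides vanish. *)
Lemma mul_weighted_mean (u : I -> R) :
  (\sum_(i in A) a i) * weighted_mean A a u = \sum_(i in A) a i * u i.
Proof.
have [s0|s_neq0] := eqVneq (\sum_(i in A) a i) 0; last by rewrite mulVKf.
rewrite s0 mul0r big1// => i iA; suff -> : a i = 0 by rewrite mul0r.
apply/eqP; move/eqP: s0; rewrite psumr_eq0 => [|j _]; last exact: ltW.
by move/allP => /(_ i (mem_index_enum _)); rewrite iA.
Qed.

(** The variance identity, by expanding the square. It turns the quadratic form of [Gpath] into a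
    sum of squares, from which both positive semidefiniteness and the decrease of one step are read
    off. *)
Lemma weighted_variance (u : I -> R) (m := weighted_mean A a u) :
  \sum_(i in A) a i * (m - u i) ^+ 2 =
  \sum_(i in A) a i * u i ^+ 2 - (\sum_(i in A) a i)^-1 * (\sum_(i in A) a i * u i) ^+ 2.
Proof.
have -> : (\sum_(i in A) a i)^-1 * (\sum_(i in A) a i * u i) ^+ 2 =
    m * \sum_(i in A) a i * u i by rewrite /m expr2 mulrA.
have sm : (\sum_(i in A) a i) * m = \sum_(i in A) a i * u i.
  exact: mul_weighted_mean.
transitivity ((\sum_(i in A) a i) * m ^+ 2 - 2 * m * (\sum_(i in A) a i * u i) +
    \sum_(i in A) a i * u i ^+ 2).
  rewrite mulr_suml mulr_sumr -sumrB -big_split /=.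
  by apply: eq_bigr => i _; ring.
by rewrite -sm; ring.
Qed.

Lemma sum_weighted_residuals (u : I -> R) :
  \sum_(i in A) a i * (weighted_mean A a u - u i) = 0.
Proof.
under eq_bigr do rewrite mulrBr.
by rewrite sumrB -mulr_suml mul_weighted_mean subrr.
Qed.

End WeightedMean.

(** * The matrices of the paths and the effect of one step *)

Section OneStep.
Context {R : realType} {n : nat} {e : rel 'I_n} {tau : nat}.
Variables (f : 'I_n -> R -> R) (L : 'I_n -> R).
Hypothesis L_gt0 : forall i, 0 < L i.
Implicit Types (N : gpath e tau) (p : gpath e tau -> R) (u w x : 'cV[R]_n).

Let Linv_gt0 i : 0 < (L i)^-1. Proof. by rewrite invr_gt0. Qed.

Lemma Gpath_form N u w : bilin (Gpath L N) u w =
  \sum_(i in vertices N) (L i)^-1 * (u i 0 * w i 0) -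
  (\sum_(i in vertices N) (L i)^-1)^-1 *
    ((\sum_(i in vertices N) (L i)^-1 * u i 0) *
     (\sum_(i in vertices N) (L i)^-1 * w i 0)).
Proof.
have ell_dot u' : ((ell L N)^T *m u') 0 0 = \sum_(i in vertices N) (L i)^-1 * u' i 0.
  rewrite mxE [RHS]big_mkcond/=; apply: eq_bigr => i _.
  by rewrite !mxE; case: ifP => // _; rewrite mul0r.
have dot_ell : (u^T *m ell L N) 0 0 = \sum_(i in vertices N) (L i)^-1 * u i 0.
  by rewrite -ell_dot -[u^T *m _]trmxK trmx_mul trmxK mxE.
rewrite /bilin /Gpath mulmxBr mulmxBl -scalemxAr -scalemxAl -!mulmxA.
rewrite [u^T *m (ell L N *m _)]mulmxA [u^T *m ell L N]mx11_scalar mul_scalar_mx.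
rewrite mxE [X in _ + X]mxE [X in _ - X]mxE [X in _ - _ * X]mxE ell_dot dot_ell.
congr (_ - _); rewrite mxE [RHS]big_mkcond/=; apply: eq_bigr => i _.
rewrite mul_diag_mx !mxE; case: ifP => _; last by rewrite mul0r mulr0.
by rewrite mulrCA.
Qed.

Lemma Gtau_form p u w : bilin (Gtau L p) u w = \sum_N p N * bilin (Gpath L N) u w.
Proof.
rewrite /bilin /Gtau mulmx_sumr mulmx_suml summxE; apply: eq_bigr => N _.
by rewrite -scalemxAr -scalemxAl mxE.
Qed.

Lemma Gpath_psd N u : 0 <= bilin (Gpath L N) u u.
Proof.
rewrite Gpath_form; under eq_bigr do rewrite -expr2.
rewrite -expr2 -(weighted_variance _ Linv_gt0 (fun i => u i 0)).
by apply: sumr_ge0 => i _; rewrite mulr_ge0 ?sqr_ge0 ?ltW.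
Qed.

Lemma Gtau_psd p u : is_distribution p -> 0 <= bilin (Gtau L p) u u.
Proof.
by case=> p0 _; rewrite Gtau_form sumr_ge0// => N _; rewrite mulr_ge0 ?Gpath_psd.
Qed.

Lemma Gtau_sym p : (Gtau L p)^T = Gtau L p.
Proof.
rewrite /Gtau linear_sum/=; apply: eq_bigr => N _.
by rewrite linearZ/= /Gpath linearB/= linearZ/= trmx_mul trmxK tr_diag_mx.
Qed.

Lemma Gtau_const1 p : Gtau L p *m const_mx 1 = 0 :> 'cV_n.
Proof.
apply/colP => i; rewrite [RHS]mxE.
have -> : (Gtau L p *m (const_mx 1 : 'cV_n)) i 0 =
    bilin (Gtau L p) (delta_mx i 0) (const_mx 1 : 'cV_n).
  by rewrite /bilin trmx_delta -mulmxA -rowE [RHS]mxE.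
rewrite Gtau_form big1// => N _; rewrite Gpath_form.
(* Against the all-ones vector, the last sum in [Gpath_form] is the total weight, which has to
   cancel its own inverse. [mul_weighted_mean] justifies this also for an empty path, where the
   weight is 0. *)
have := mul_weighted_mean (vertices N) Linv_gt0 (fun j => (delta_mx i 0 : 'cV_n) j 0).
under [X in _ - _ * (_ * X)]eq_bigr do rewrite mxE mulr1.
under [X in X - _]eq_bigr do rewrite [X in _ * (_ * X)]mxE mulr1.
by move=> sE; rewrite [X in _ - X]mulrA [X in _ - X]mulrC sE subrr mulr0.
Qed.

Hypothesis f_derivable : forall i t, derivable (f i) t 1.
Hypothesis f_lipschitz :
  forall i s t, `|derive1 (f i) s - derive1 (f i) t| <= L i * `|s - t|.

(** This is the Lagrange multiplier for minimizing the sum over the path of g_i d_i + L_i / 2 d_i^2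
    under the constraint that the d_i sum to zero; [rcd_dir] is the minimizer. *)
Definition grad_mean N x : R :=
  weighted_mean (vertices N) (fun i => (L i)^-1) (fun i => grad (sepfun f) x i 0).

Lemma rcd_dirE N x i : i \in vertices N ->
  rcd_dir f L N x i = (L i)^-1 * (grad_mean N x - grad (sepfun f) x i 0).
Proof.
move=> iN; rewrite /rcd_dir; congr (_ * _).
have s_neq0 : \sum_(j in vertices N) (L j)^-1 != 0.
  rewrite psumr_neq0 => [|j _]; last exact: ltW.
  by apply/hasP; exists i; rewrite ?mem_index_enum// iN /=.
under eq_bigr do rewrite mulrBr.
rewrite sumrB -mulr_suml mulrBl mulrAC divff// mul1r grad_sepfun mulrC; congr (_ * _ - _).
by apply: eq_bigr => j _; rewrite grad_sepfun.
Qed.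

Lemma rcd_step_zero_sum N x : zero_sum x -> zero_sum (rcd_step f L N x).
Proof.
rewrite /zero_sum/= => x0.
transitivity (\sum_i x i 0 + \sum_(i in vertices N) rcd_dir f L N x i).
  rewrite [X in _ + X]big_mkcond -big_split/=; apply: eq_bigr => i _.
  by rewrite mxE; case: ifP; rewrite ?addr0.
rewrite x0 add0r (eq_bigr _ (rcd_dirE x)).
exact: sum_weighted_residuals.
Qed.

Lemma rcd_step_decrease N x (g := grad (sepfun f) x) :
  sepfun f (rcd_step f L N x) <= sepfun f x - 2^-1 * bilin (Gpath L N) g g.
Proof.
have -> : bilin (Gpath L N) g g =
    \sum_(i in vertices N) (L i)^-1 * (grad_mean N x - g i 0) ^+ 2.
  rewrite Gpath_form (weighted_variance _ Linv_gt0 (fun i => g i 0)) -expr2.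
  by under eq_bigr do rewrite -expr2.
(* Let m be the mean and r_i = m - g_i. At d_i = r_i / L_i the model g_i d_i + L_i / 2 d_i^2 equals
   m r_i / L_i - r_i^2 / (2 L_i), and the first terms sum to zero over the path. *)
suff : sepfun f (rcd_step f L N x) <= sepfun f x +
    \sum_(i in vertices N) (grad_mean N x * ((L i)^-1 * (grad_mean N x - g i 0))
      - 2^-1 * ((L i)^-1 * (grad_mean N x - g i 0) ^+ 2)).
  rewrite sumrB -!mulr_sumr.
  by rewrite (sum_weighted_residuals _ Linv_gt0 (fun i => g i 0)) mulr0 sub0r.
rewrite [X in _ + X]big_mkcond -big_split/=; apply: ler_sum => i _.
rewrite mxE; case: ifP => iN; last by rewrite addr0.
apply: le_trans (descent_lemma (@f_derivable i) (@f_lipschitz i) _ _) _.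
rewrite rcd_dirE// -grad_sepfun -/g -addrA lerD2l le_eqVlt; apply/orP; left.
by apply/eqP; field; rewrite ?lt0r_neq0.
Qed.

Lemma rcd_expected_decrease p x (g := grad (sepfun f) x) : is_distribution p ->
  \sum_N p N * sepfun f (rcd_step f L N x) <=
  sepfun f x - 2^-1 * bilin (Gtau L p) g g.
Proof.
case=> p0 p1; rewrite Gtau_form.
have -> : sepfun f x = \sum_N p N * sepfun f x by rewrite -mulr_suml p1 mul1r.
rewrite mulr_sumr -sumrB.
apply: ler_sum => N _; apply: le_trans (ler_wpM2l (p0 N) (rcd_step_decrease N x)) _.
by rewrite mulrBr [X in _ - X]mulrCA.
Qed.

End OneStep.

(** * The dual norm on zero-sum vectors *)

Section DualNorm.
Context {R : realType} {n : nat}.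
Variable G : 'M[R]_n.
Implicit Types u v w : 'cV[R]_n.
Hypothesis G_sym : G^T = G.
Hypothesis G_psd : forall u, 0 <= bilin G u u.
Hypothesis G_const1 : G *m const_mx 1 = 0 :> 'cV_n.
Hypothesis G_simple : simple_eigenvalue G 0.

Lemma dotvE (x y : 'cV[R]_n) : dotv x y = (x^T *m y) 0 0.
Proof. by rewrite mxE; apply: eq_bigr => i _; rewrite mxE. Qed.

Lemma dotvC (x y : 'cV[R]_n) : dotv x y = dotv y x.
Proof. by apply: eq_bigr => i _; rewrite mulrC. Qed.

Lemma mxnorm_le u c : 0 <= c -> (mxnorm G u <= c) = (bilin G u u <= c ^+ 2).
Proof.
move=> c0; rewrite /mxnorm -{1}(ger0_norm c0) -sqrtr_sqr ler_sqrt//.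
exact: sqr_ge0.
Qed.

(** Writing v = G w turns the pairing with u into the G-form of w and u. Nonnegativity of the form
    at w - u bounds it by half the sum of the forms at w and at u, and the latter is at most 1. *)
Lemma dual_mxnorm_ubound v : zero_sum v ->
  has_ubound [set dotv v u | u in [set u | mxnorm G u <= 1]].
Proof.
move=> /(zero_sum_image G_sym G_const1 G_simple)[w ->].
exists (2^-1 * (bilin G w w + 1)) => _ [u /= u1 <-].
move: u1; rewrite mxnorm_le// expr1n => u1.
have wu : dotv (G *m w) u = bilin G w u by rewrite dotvE trmx_mul G_sym.
have uw : bilin G u w = bilin G w u by rewrite -wu dotvC dotvE mulmxA.
have : bilin G (w - u) (w - u) = bilin G w w - 2 * bilin G w u + bilin G u u.
  transitivity (bilin G w w - bilin G w u - bilin G u w + bilin G u u);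
    last by rewrite uw; ring.
  rewrite /bilin [(w - u)^T]linearB/= !mulmxBl !mulmxBr !mxE; ring.
by have := G_psd (w - u); rewrite wu; lra.
Qed.

Lemma dual_mxnorm_ge0 v : zero_sum v -> 0 <= dual_mxnorm G v.
Proof.
move=> v0; apply: ub_le_sup; first exact: dual_mxnorm_ubound.
exists 0; last by rewrite dotvE mulmx0 mxE.
by rewrite /= mxnorm_le// /bilin mulmx0 mxE expr1n.
Qed.

(** Scaling u by c^-1 puts it in the unit ball. The number c is any positive bound on the seminorm
    of u rather than its value, because the seminorm can vanish at u. *)
Lemma dotv_le_dual v u c : zero_sum v -> 0 < c -> bilin G u u <= c ^+ 2 ->
  dotv v u <= c * dual_mxnorm G v.
Proof.
move=> v0 c0 uc; rewrite mulrC -ler_pdivrMr//.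
apply: ub_le_sup; first exact: dual_mxnorm_ubound.
exists (c^-1 *: u); last by rewrite dotvE -scalemxAr mxE mulrC -dotvE.
have scaled : bilin G (c^-1 *: u) (c^-1 *: u) = c^-1 ^+ 2 * bilin G u u.
  by rewrite /bilin [(c^-1 *: u)^T]linearZ/= -!scalemxAl -scalemxAr !mxE; ring.
by rewrite /= mxnorm_le// scaled expr1n exprVn mulrC ler_pdivrMr ?mul1r// exprn_gt0.
Qed.

Lemma dotv_young v u (sigma : R) : zero_sum v -> 0 < sigma ->
  sigma * dotv v u <= 2^-1 * bilin G u u + sigma ^+ 2 / 2 * dual_mxnorm G v ^+ 2.
Proof.
move=> v0 s0; set D := dual_mxnorm G v.
have D0 : 0 <= D by exact: dual_mxnorm_ge0.
have Q0 := G_psd u; set Q := bilin G u u in Q0 *.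
(* When the seminorm of u is 0, [dotv_le_dual] holds for every c > 0, and c can be chosen freely. *)
have [Q_eq0|Q_neq0] := eqVneq Q 0.
  have bound c : 0 < c -> dotv v u <= c * D.
    by move=> c0; apply: dotv_le_dual => //; rewrite -/Q Q_eq0 sqr_ge0.
  rewrite Q_eq0 mulr0 add0r.
  have [D_eq0|D_neq0] := eqVneq D 0.
    by have := bound 1 ltr01; rewrite D_eq0 mulr0 expr0n mulr0 => ?; rewrite pmulr_rle0.
  have D_gt0 : 0 < D by rewrite lt_def D_neq0.
  (* This c makes sigma * (c * D) exactly the dual-norm term of the goal. *)
  have /bound : 0 < sigma / 2 * D by rewrite mulr_gt0// divr_gt0.
  by move=> /(ler_wpM2l (ltW s0)) /le_trans; apply; rewrite le_eqVlt; apply/orP; left;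
    apply/eqP; field.
have Q_gt0 : 0 < Q by rewrite lt_def Q_neq0.
have sQ : Num.sqrt Q ^+ 2 = Q by rewrite sqr_sqrtr.
have : dotv v u <= Num.sqrt Q * D.
  by apply: dotv_le_dual; rewrite ?sqrtr_gt0// sQ.
move=> /(ler_wpM2l (ltW s0)) /le_trans; apply.
rewrite -[in leRHS]sQ -subr_ge0.
(* Young's inequality: the gap between the two sides is half a square. *)
rewrite [X in 0 <= X](_ : _ = 2^-1 * (Num.sqrt Q - sigma * D) ^+ 2); last by field.
by rewrite mulr_ge0 ?sqr_ge0// invr_ge0.
Qed.

End DualNorm.

(** * Finite histories of draws and their laws *)

Section Draws.
Context {R : realType} {d : measure_display} {T : measurableType d}.
Variables (P : probability T R) (I : finType) (p : I -> R) (draws : nat -> T -> I).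
Hypothesis draws_indep : independent_draws P p draws.
Variable a0 : I.

Definition history k w : {ffun 'I_k -> I} := [ffun j : 'I_k => draws j w].

(** Both [rcd] and [independent_draws] take infinite sequences, so a finite history is padded with
    the default [a0]; only indices below k matter. *)
Definition extend {k} (h : {ffun 'I_k -> I}) (j : nat) : I :=
  if insub j is Some j' then h j' else a0.

Lemma extend_history k w j : (j < k)%N -> extend (history k w) j = draws j w.
Proof. by move=> jk; rewrite /extend insubT/= ffunE. Qed.

Lemma history_fiber k (h : {ffun 'I_k -> I}) :
  history k @^-1` [set h] = [set w | forall j, (j < k)%N -> draws j w = extend h j].
Proof.
apply/seteqP; split=> w /=.
  by move=> <- j jk; rewrite extend_history.
by move=> hw; apply/ffunP => j; rewrite ffunE hw// /extend valK.
Qed.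

Lemma measurable_history_fiber k (h : {ffun 'I_k -> I}) :
  measurable (history k @^-1` [set h]).
Proof.
have [mdraws _ _] := draws_indep.
rewrite history_fiber (_ : [set w | _] =
    \bigcap_(j in [set j | (j < k)%N]) draws j @^-1` [set extend h j]).
  by apply: bigcap_measurableType => j _; exact: mdraws.
by apply/seteqP; split.
Qed.

Definition history_law k (h : {ffun 'I_k -> I}) : R :=
  fine (P (history k @^-1` [set h])).

Lemma expectation_history k (Phi : {ffun 'I_k -> I} -> R) :
  ('E_P[Phi \o history k] = (\sum_h history_law h * Phi h)%R%:E)%E.
Proof.
rewrite expectation_comp_fin; last exact: measurable_history_fiber.
by congr (_%:E); apply: eq_bigr => h _; rewrite mulrC.
Qed.

Lemma history_law_distribution k : is_distribution (@history_law k).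
Proof.
split=> [h|]; first exact: fine_ge0.
have := @expectation_history k (cst 1).
rewrite (_ : cst 1 \o history k = cst 1)// expectation_cst => -[->].
by apply: eq_bigr => h _; rewrite mulr1.
Qed.

(** A finite form of conditioning on the past: each joint fiber of history and next draw is an
    intersection, whose probability factors by independence. *)
Lemma expectation_next_draw k (Phi : {ffun 'I_k -> I} -> I -> R) :
  ('E_P[fun w => Phi (history k w) (draws k w)] =
    (\sum_h history_law h * \sum_a p a * Phi h a)%R%:E)%E.
Proof.
have [mdraws law_draws indep] := draws_indep.
pose Z w := (history k w, draws k w).
have fiberZ j : Z @^-1` [set j] =
    history k @^-1` [set j.1] `&` draws k @^-1` [set j.2].
  by apply/seteqP; split=> w /=; case: j => h a /= [<- <-].
have := @expectation_comp_fin _ _ _ P _ Z (fun j => Phi j.1 j.2).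
rewrite /comp /= => -> => [|j]; last first.
  rewrite fiberZ; apply: measurableI => //.
  exact: measurable_history_fiber.
congr (_%:E); under [RHS]eq_bigr do rewrite mulr_sumr.
rewrite pair_bigA/=; apply: eq_bigr => -[h a] _ /=.
rewrite fiberZ/= history_fiber indep law_draws -history_fiber fineM//.
- by rewrite /history_law mulrC -mulrA.
- by apply: fin_num_measure; exact: measurable_history_fiber.
Qed.

End Draws.

(** * From one step to the linear rate *)

(** Adaptedness of the iterates, which allows iterate k to be treated as a function of a finite
    history. *)
Lemma rcd_eq_draws (R : realType) n (e : rel 'I_n) tau (f : 'I_n -> R -> R)
    (L : 'I_n -> R) x0 (s t : nat -> gpath e tau) k :
  (forall j, (j < k)%N -> s j = t j) -> rcd f L x0 s k = rcd f L x0 t k.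
Proof.
elim: k => //= k IHk st; rewrite IHk => [|j jk]; last by rewrite st// ltnW.
by rewrite st.
Qed.

Lemma rcd_zero_sum (R : realType) n (e : rel 'I_n) tau (f : 'I_n -> R -> R)
    (L : 'I_n -> R) x0 (s : nat -> gpath e tau) k :
  (forall i, 0 < L i) -> zero_sum x0 -> zero_sum (rcd f L x0 s k).
Proof. by move=> L0 x00; elim: k => //= k; exact: rcd_step_zero_sum. Qed.

Lemma rcd_expected_contraction (R : realType) n (e : rel 'I_n) tau
    (p : gpath e tau -> R) (f : 'I_n -> R -> R) (L : 'I_n -> R) (sigma fstar : R) x :
  is_distribution p ->
  (forall i, 0 < L i) ->
  (forall i t, derivable (f i) t 1) ->
  (forall i s t, `|derive1 (f i) s - derive1 (f i) t| <= L i * `|s - t|) ->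
  simple_eigenvalue (Gtau L p) 0 ->
  0 < sigma ->
  strongly_convex_on zero_sum (dual_mxnorm (Gtau L p)) (sepfun f) sigma ->
  (sepfun f @` zero_sum) fstar -> zero_sum x ->
  \sum_N p N * sepfun f (rcd_step f L N x) <= fstar + (1 - sigma) * (sepfun f x - fstar).
Proof.
move=> p_distr L0 df lip simpleG sigma0 convex [xs xs0 <-] x_0.
have v0 : zero_sum (xs - x).
  rewrite /zero_sum/=; under eq_bigr do rewrite !mxE.
  by rewrite sumrB xs0 x_0 subrr.
have psd u : 0 <= bilin (Gtau L p) u u by exact: Gtau_psd.
apply: le_trans (rcd_expected_decrease L0 df lip x p_distr) _.
set g := grad (sepfun f) x.
have gN : bilin (Gtau L p) (- g) (- g) = bilin (Gtau L p) g g.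
  by rewrite /bilin mulmxN [(- g)^T]linearN/= !mulNmx opprK.
have dotN : dotv (xs - x) (- g) = - dotv g (xs - x).
  by rewrite /dotv -sumrN; apply: eq_bigr => i _; rewrite [(- g) _ _]mxE mulrN mulrC.
(* Young's inequality is applied at -g because the pairing of g with xs - x has to be bounded from
   below. *)
have := dotv_young (Gtau_sym L p) psd (Gtau_const1 L0 p) simpleG (- g) v0 sigma0.
rewrite gN dotN => young.
(* Scaled by sigma, strong convexity carries the same dual-norm term as [young]. The two cancel,
   leaving sigma (f x - fstar) at most half the form at g. *)
have := ler_wpM2l (ltW sigma0) (convex xs x xs0 x_0); rewrite -/g.
lra.
Qed.

Unset Implicit Arguments.

Theorem theorem3p2 (R : realType) (n : nat)
    (e : rel 'I_n) (e_sym : symmetric e) (e_conn : forall i j, connect e i j)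
    (tau : nat) (tau_ge2 : (2 <= tau)%N) (tau_le : (tau <= n)%N)
    (p : gpath e tau -> R) (p_distr : is_distribution p)
    (f : 'I_n -> R -> R) (L : 'I_n -> R) (sigma fstar : R) (x0 : 'cV[R]_n)
    (d : measure_display) (T : measurableType d) (P : probability T R)
    (draws : nat -> T -> gpath e tau) :
  (forall i, 0 < L i) ->
  (forall i, @convex_function R R^o [set: R] (f i)) ->
  (forall i t, derivable (f i) t 1) ->
  (forall i s t, `|derive1 (f i) s - derive1 (f i) t| <= L i * `|s - t|) ->
  simple_eigenvalue (Gtau L p) 0 ->
  0 < sigma ->
  strongly_convex_on zero_sum (dual_mxnorm (Gtau L p)) (sepfun f) sigma ->
  zero_sum x0 ->
  (sepfun f @` zero_sum) fstar -> lbound (sepfun f @` zero_sum) fstar ->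
  independent_draws P p draws ->
  forall k : nat,
    ('E_P[fun w => sepfun f (rcd f L x0 (draws ^~ w) k)] - fstar%:E
       <= ((1 - sigma) ^+ k * (sepfun f x0 - fstar))%:E)%E.
Proof.
move=> L0 _ df lip simpleG sigma0 convex x00 fstar_attained fstar_lb indep k.
have contraction :=
  rcd_expected_contraction p_distr L0 df lip simpleG sigma0 convex fstar_attained.
have fstar_le x : zero_sum x -> fstar <= sepfun f x.
  by move=> x_0; apply: fstar_lb; exists x.
(* Some path exists because the weights [p] sum to 1; it serves as the padding value of [extend]. *)
have [a0 _] : exists a0 : gpath e tau, True.
  case: (pickP (fun _ : gpath e tau => true)) => [a _|noa]; first by exists a.
  have [_ /eqP] := p_distr; rewrite big1 => [|a _]; first by rewrite eq_sym oner_eq0.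
  by have := noa a.
pose X j (h : {ffun 'I_j -> gpath e tau}) := rcd f L x0 (extend a0 h) j.
have X_0 j h : zero_sum (X j h) by exact: rcd_zero_sum.
have X_history j w : rcd f L x0 (draws ^~ w) j = X j (history draws j w).
  by apply: rcd_eq_draws => i ij; rewrite extend_history.
pose q j := @history_law _ _ _ P _ draws j.
have q_distr j : is_distribution (q j) by exact: history_law_distribution indep a0 j.
pose phi j := \sum_h q j h * sepfun f (X j h).
have phiE j : ('E_P[fun w => sepfun f (rcd f L x0 (draws ^~ w) j)] = (phi j)%:E)%E.
  under [X in expectation _ X]eq_fun do rewrite X_history.
  exact: (expectation_history indep a0 (fun h => sepfun f (X j h))).
have phi_ge j : fstar <= phi j.
  have [q0 q1] := q_distr j; rewrite -[fstar]mul1r -q1 mulr_suml.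
  by apply: ler_sum => h _; rewrite ler_wpM2l// fstar_le.
have phiS j : phi j.+1 - fstar <= (1 - sigma) * (phi j - fstar).
  have [q0 q1] := q_distr j.
  have -> : phi j.+1 =
      \sum_h q j h * \sum_N p N * sepfun f (rcd_step f L N (X j h)).
    apply: EFin_inj; rewrite -phiE.
    under [X in expectation _ X]eq_fun do rewrite /= X_history.
    exact: (expectation_next_draw indep a0
      (fun h N => sepfun f (rcd_step f L N (X j h)))).
  rewrite lerBlDl.
  (* The one-step bound is affine in the objective value, so it commutes with averaging over
     histories. *)
  have -> : fstar + (1 - sigma) * (phi j - fstar) =
      \sum_h q j h * (fstar + (1 - sigma) * (sepfun f (X j h) - fstar)).
    under eq_bigr do rewrite mulrDr mulrCA mulrBr.
    by rewrite big_split/= -mulr_sumr sumrB -!mulr_suml q1 !mul1r.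
  by apply: ler_sum => h _; rewrite ler_wpM2l// contraction.
rewrite phiE -EFinB lee_fin.
have phi0 : phi 0 = sepfun f x0.
  have [_ q1] := q_distr 0%N.
  by rewrite /phi -[RHS]mul1r -q1 mulr_suml.
elim: k => [|k IHk]; first by rewrite expr0 mul1r phi0.
(* The induction hypothesis can be multiplied by 1 - sigma only when this factor is nonnegative. *)
have [sigma_le1|sigma_gt1] := leP sigma 1.
  apply: le_trans (phiS k) _; rewrite exprS -mulrA.
  by rewrite ler_wpM2l// subr_ge0.
(* For [1 < sigma] the contraction forces [phi] to stay at its minimum. *)
have phi_min j : phi j = fstar.
  apply/eqP; rewrite eq_le phi_ge andbT -subr_le0.
  rewrite -(@nmulr_rge0 _ (1 - sigma)) ?subr_lt0//.
  by apply: le_trans (phiS j); rewrite subr_ge0.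
by rewrite -phi0 !phi_min subrr mulr0.
Qed.
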